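(* Let $\mathsf{z}$ be a finite positive measure on a measurable space $\Omega$ and write $\mathbb{E}[\mathsf{a}]=\int_{\Omega}\mathsf{a}\,d\mathsf{z}$. Let $\mathsf{a}_1,\dots,\mathsf{a}_N:\Omega\to[0,\infty)$ be measurable functions with $\mathbb{E}[\mathsf{a}_n]<\infty$ for each $n$, and let $\lambda_1,\dots,\lambda_N\in\mathbb{R}$. Define the $N\times N$ matrices $Q$ and $\Lambda$ by $$Q_{mn}=\mathbb{E}\big[\sqrt{\mathsf{a}_m\mathsf{a}_n}\big],\qquad \Lambda_{mn}=\lambda_n\delta_{mn}.$$ Let $S$ be any (real or complex) matrix, with $N$ columns and finitely many rows, such that $Q=S^{\ast}S$, and define the self-adjoint matrix $P=S\Lambda S^{\ast}$. Then $$\mathbb{E}\Big[\Big(\sum_{n=1}^N\lambda_n\mathsf{a}_n\Big)^{+}\Big]\ \le\ \sum_i p_i^{+},$$ where $p_i$ are the eigenvalues of $P$ counted with multiplicity; that is, the left-hand side is bounded above by the sum of the positive eigenvalues of $P$.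
   Context: For a real number or real-valued function $x$, $x^{+}=\max(x,0)$. $S^{\ast}$ is the conjugate transpose of $S$. The matrix $Q$ is positive semi-definite, so decompositions $Q=S^{\ast}S$ exist. In financial terms, $\Omega$ is the state space of the economy, securities are real-valued (measurable) functions on it, an arbitrage-free pricing model is the integral against a finite positive measure, assets are positive securities $\mathsf{a}_n$, and the $\lambda_n$ are the quantities held in a portfolio. *)

(* Defs.v *)
From HB Require Import structures.
From mathcomp Require Import all_boot all_order all_algebra.
From mathcomp Require Import all_classical all_reals all_analysis.
From mathcomp Require Import complex.
Set Implicit Arguments.
Unset Strict Implicit.
Unset Printing Implicit Defensive.
Import Order.TTheory GRing.Theory Num.Theory.
Import numFieldNormedType.Exports.
Local Open Scope ring_scope.
Local Open Scope sesquilinear_scope.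

Definition price (R : realType) (d : measure_display)
    (T : measurableType d) (z : {measure set T -> \bar R}) (f : T -> R) :
    \bar R :=
  (\int[z]_w (f w)%:E)%E.

(* For nonnegative integrable [a_n] the integrals below are finite, since
   sqrt (a_m a_n) <= (a_m + a_n) / 2, so [fine] loses nothing. *)
Definition Qmx (R : realType) (d : measure_display) (T : measurableType d)
    (z : {measure set T -> \bar R}) (N : nat) (a : 'I_N -> T -> R) :
    'M[R]_N :=
  \matrix_(m < N, n < N)
    fine (price z (fun w => Num.sqrt (a m w * a n w))).

Definition Lambdamx (R : realType) (N : nat) (lambda : 'I_N -> R) : 'M[R]_N :=
  \matrix_(m < N, n < N) (lambda n *+ (m == n)).

Definition complexmx (R : realType) (m n : nat) (A : 'M[R]_(m, n)) :
    'M[R[i]]_(m, n) :=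
  map_mx (real_complex R) A.

Definition Pmx (R : realType) (k N : nat) (S : 'M[R[i]]_(k, N))
    (lambda : 'I_N -> R) : 'M[R[i]]_k :=
  S *m complexmx (Lambdamx lambda) *m S ^t*.

Definition eigenvalues (C : closedFieldType) (k : nat) (A : 'M[C]_k) : seq C :=
  sval (closed_field_poly_normal (char_poly A)).

Lemma char_poly_eigenvalues (C : closedFieldType) (k : nat) (A : 'M[C]_k) :
  char_poly A = \prod_(p <- eigenvalues A) ('X - p%:P).
Proof.
rewrite /eigenvalues; case: closed_field_poly_normal => s /= {1}->.
by rewrite (monicP (char_poly_monic A)) scale1r.
Qed.

Lemma size_eigenvalues (C : closedFieldType) (k : nat) (A : 'M[C]_k) :
  size (eigenvalues A) = k.
Proof.
have := size_char_poly A; rewrite char_poly_eigenvalues size_prod_XsubC.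
by case.
Qed.

Lemma Pmx_selfadjoint (R : realType) (k N : nat) (S : 'M[R[i]]_(k, N))
    (lambda : 'I_N -> R) : (Pmx S lambda) ^t* = Pmx S lambda.
Proof.
have LC : (complexmx (Lambdamx lambda)) ^t* = complexmx (Lambdamx lambda).
  apply/matrixP => i j; rewrite !mxE eq_sym.
  by case: eqVneq => [->|_]; apply/eqP; rewrite eq_complex /= ?oppr0 !eqxx.
by rewrite /Pmx !trmx_mul !map_mxM LC trmxCK mulmxA.
Qed.

Lemma eigenvalues_selfadjoint_real (C : numClosedFieldType) (k : nat)
    (A : 'M[C]_k) (p : C) :
  A ^t* = A -> p \in eigenvalues A -> p \is Num.real.
Proof.
move=> Aadj; rewrite -root_prod_XsubC -char_poly_eigenvalues.
rewrite -eigenvalue_root_char => /eigenvalueP[v vA v0].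
have vv0 : (v *m v ^t*) 0 0 != 0.
  apply: contra v0 => /eqP; rewrite mxE => s0; apply/eqP/rowP => j; rewrite mxE.
  have /psumr_eq0P -/(_ _ j isT) : forall i : 'I_k, true -> 0 <= v 0 i * v ^t* i 0.
    by move=> i _; rewrite !mxE mul_conjC_ge0.
  by move=> /(_ s0) /eqP; rewrite !mxE mul_conjC_eq0 => /eqP.
have : v *m A *m v ^t* = v *m (v *m A) ^t*.
  by rewrite trmx_mul map_mxM Aadj mulmxA.
rewrite vA linearZ /= map_mxZ -scalemxAl -scalemxAr => /matrixP/(_ 0 0).
rewrite [LHS]mxE [RHS]mxE => /(mulIf vv0) e.
by apply/CrealP; rewrite -e.
Qed.

(* [Re] only casts back to [R]: the eigenvalues of [Pmx S lambda] are real by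
   [Pmx_selfadjoint] and [eigenvalues_selfadjoint_real]. *)
Definition sum_pos_eigenvalues (R : realType) (k : nat) (A : 'M[R[i]]_k) : R :=
  \sum_(p <- eigenvalues A) Num.max (complex.Re p) 0.

(* Main.v *)
(* Let v(w) be the column vector of the sqrt (a_n w), so that Q = E[v v^T] and
   sum_n lambda_n a_n = v^T Lambda v.  With A = S S^* and B a generalized
   inverse of A such that B A is the orthogonal projection onto the range of S,
   the matrix X = 1 - S^* B S kills S^*; hence E|X v|^2 = tr (X Q X^* ) = 0,
   i.e. v = S^* u almost everywhere with u = B S v.  There v^T Lambda v = u^* P u
   is at most u^* P^+ u, P^+ being the positive part of P, and
   E[u^* P^+ u] = tr (P^+ B A) <= tr P^+, which is the sum of the positive
   eigenvalues of P. *)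
Require Import Defs.
From HB Require Import structures.
From mathcomp Require Import all_boot all_order all_algebra.
From mathcomp Require Import all_classical all_reals all_analysis.
From mathcomp Require Import complex.
From mathcomp Require Import measurable_realfun lra.
Import Order.TTheory GRing.Theory Num.Theory.
Import numFieldNormedType.Exports.
Local Open Scope ring_scope.
Local Open Scope sesquilinear_scope.

(** * Traces and spectral decomposition of self-adjoint matrices *)

Lemma psd_diag_ge0 {C : numClosedFieldType} {m n : nat} (Y : 'M[C]_(m, n)) i :
  0 <= (Y *m Y ^t*) i i.
Proof. by rewrite mxE sumr_ge0// => j _; rewrite !mxE mul_conjC_ge0. Qed.

Lemma mxtrace_psd_ge0 {C : numClosedFieldType} {m n : nat} (Y : 'M[C]_(m, n)) :
  0 <= \tr (Y *m Y ^t*).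
Proof. by apply: sumr_ge0 => i _; exact: psd_diag_ge0. Qed.

(** The trace is the sum of the squared moduli of the entries of [Y]. *)
Lemma mxtrace_mul_adj_eq0 {C : numClosedFieldType} {m n : nat}
    {Y : 'M[C]_(m, n)} :
  \tr (Y *m Y ^t*) = 0 -> Y = 0.
Proof.
move=> /psumr_eq0P Y0; apply/matrixP => i j; rewrite mxE.
have := Y0 (fun i _ => psd_diag_ge0 Y i) i isT.
rewrite mxE => /psumr_eq0P/(_ j isT)/eqP.
rewrite !mxE mul_conjC_eq0 => Yij; apply/eqP/Yij => l _.
by rewrite !mxE mul_conjC_ge0.
Qed.

Lemma selfadjoint_spectral {C : numClosedFieldType} {n : nat} {A : 'M[C]_n} :
  A ^t* = A ->
  A = (spectralmx A) ^t* *m diag_mx (spectral_diag A) *m spectralmx A.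
Proof.
move=> AA; have /orthomx_spectralP {1}-> : A \is normalmx.
  by apply/normalmxP; rewrite AA.
by rewrite invmx_unitary ?spectral_unitarymx.
Qed.

Lemma spectralmxMadj {C : numClosedFieldType} {n : nat} (A : 'M[C]_n) :
  spectralmx A *m (spectralmx A) ^t* = 1%:M.
Proof. exact/unitarymxP/spectral_unitarymx. Qed.

Lemma spectralmx_adjM {C : numClosedFieldType} {n : nat} (A : 'M[C]_n) :
  (spectralmx A) ^t* *m spectralmx A = 1%:M.
Proof. exact/mulmx1C/spectralmxMadj. Qed.

Lemma char_poly_conj {F : comNzRingType} {n : nat} (U V D : 'M[F]_n) :
  V *m U = 1%:M -> char_poly (V *m D *m U) = char_poly D.
Proof.
move=> VU; rewrite /char_poly /char_poly_mx.
have fVU : map_mx polyC V *m map_mx polyC U = 1%:M.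
  by rewrite -map_mxM VU map_mx1.
have -> : 'X%:M - map_mx polyC (V *m D *m U) =
    map_mx polyC V *m ('X%:M - map_mx polyC D) *m map_mx polyC U.
  rewrite mulmxBr mulmxBl !map_mxM/=; congr (_ - _).
  by rewrite scalar_mxC -mulmxA fVU mulmx1.
by rewrite !det_mulmx mulrAC -det_mulmx fVU det1 mul1r.
Qed.

(** Both lists are the roots of the same polynomial, since [A] is similar to the diagonal matrix of
    [spectral_diag A]. *)
Lemma perm_eigenvalues_spectral {C : numClosedFieldType} {n : nat}
    {A : 'M[C]_n} :
  A ^t* = A ->
  perm_eq (eigenvalues A) [seq spectral_diag A 0 i | i : 'I_n].
Proof.
move=> AA; apply: prod_XsubC_eq.
rewrite -char_poly_eigenvalues big_map big_enum/=.
rewrite {1}(selfadjoint_spectral AA) char_poly_conj ?spectralmx_adjM//.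
rewrite char_poly_trig; last exact/diag_mx_is_trig.
by apply: eq_bigr => i _; rewrite mxE eqxx.
Qed.

Lemma selfadjoint_pinv {C : numClosedFieldType} {n : nat} {A : 'M[C]_n} :
  A ^t* = A ->
  exists B : 'M[C]_n,
    [/\ A *m B *m A = A, (B *m A) ^t* = B *m A
      & B *m A *m (B *m A) = B *m A].
Proof.
move=> AA; pose U := spectralmx A; pose d := spectral_diag A.
(* [B] inverts [A] on each eigenvector with nonzero eigenvalue, so [B *m A] has the 0/1 diagonal [c]
   in the eigenbasis. *)
pose e : 'rV[C]_n := \row_i (d 0 i)^-1.
pose c : 'rV[C]_n := \row_i (d 0 i != 0)%:R.
have AE : A = U ^t* *m diag_mx d *m U := selfadjoint_spectral AA.
have UU X : U *m (U ^t* *m X) = X by rewrite mulmxA spectralmxMadj mul1mx.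
exists (U ^t* *m diag_mx e *m U).
have BA : U ^t* *m diag_mx e *m U *m A = U ^t* *m diag_mx c *m U.
  rewrite [in LHS]AE -!mulmxA UU; congr (_ *m _); rewrite !mulmxA mulmx_diag.
  congr (diag_mx _ *m _); apply/rowP => i; rewrite !mxE.
  by have [->|d0] := eqVneq (d 0 i) 0; rewrite ?mulr0// mulVf.
rewrite -[A *m _ *m _]mulmxA BA; split.
- rewrite [in LHS]AE [RHS]AE -!mulmxA UU; congr (_ *m _).
  rewrite !mulmxA mulmx_diag; congr (diag_mx _ *m _).
  apply/rowP => i; rewrite !mxE.
  by have [->|d0] := eqVneq (d 0 i) 0; rewrite ?mulr0// mulr1.
- rewrite !trmx_mul !map_mxM trmxCK mulmxA tr_diag_mx map_diag_mx.
  by congr (_ *m diag_mx _ *m _); apply/rowP => i; rewrite !mxE rmorph_nat.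
- rewrite -!mulmxA UU; congr (_ *m _); rewrite mulmxA mulmx_diag.
  congr (diag_mx _ *m _); apply/rowP => i; rewrite !mxE.
  by case: eqVneq; rewrite ?mulr0 ?mulr1.
Qed.

Lemma mxtrace_diagM {F : comNzRingType} {n : nat} (d : 'rV[F]_n) (X : 'M[F]_n) :
  \tr (diag_mx d *m X) = \sum_i d 0 i * X i i.
Proof. by apply: eq_bigr => i _; rewrite mul_diag_mx mxE. Qed.

(** * From complex to real matrices, and the pointwise majorant *)

Lemma Re_mxtrace_complexmx {R : realType} {n : nat} (K : 'M[R[i]]_n)
    (W : 'M[R]_n) :
  complex.Re (\tr (K *m complexmx W)) = \tr (map_mx (@complex.Re R) K *m W).
Proof.
have ReS := raddf_sum (@complex.Re R : {additive _ -> _}).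
rewrite /mxtrace ReS; apply: eq_bigr => i _; rewrite !mxE ReS.
by apply: eq_bigr => j _; rewrite !mxE; case: (K i j) => x y /=;
  rewrite mulr0 subr0.
Qed.

Lemma complexmx_adj {R : realType} {m n : nat} (A : 'M[R]_(m, n)) :
  (complexmx A) ^t* = complexmx A^T.
Proof.
by apply/matrixP => i j; rewrite !mxE; apply/eqP;
  rewrite eq_complex /= oppr0 !eqxx.
Qed.

Lemma complexmxM {R : realType} {m n p : nat} (A : 'M[R]_(m, n))
    (B : 'M[R]_(n, p)) :
  complexmx (A *m B) = complexmx A *m complexmx B.
Proof. exact: map_mxM. Qed.

(* [\tr (G *m (v *m v^T))] is the quadratic form of [u^* P^+ u] and
   [\tr (E *m (v *m v^T))] that of [|X v|^2]; both are real matrices so that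
   they can be integrated entrywise against [Q]. *)
Lemma portfolio_majorant {R : realType} {N k : nat} {Q : 'M[R]_N}
    (lambda : 'I_N -> R) {S : 'M[R[i]]_(k, N)} :
  complexmx Q = S ^t* *m S ->
  exists G E : 'M[R]_N,
    [/\ forall v : 'cV[R]_N, 0 <= \tr (G *m (v *m v^T)),
        forall v : 'cV[R]_N, 0 <= \tr (E *m (v *m v^T)),
        forall v : 'cV[R]_N, \tr (E *m (v *m v^T)) = 0 ->
          \sum_n lambda n * v n 0 ^+ 2 <= \tr (G *m (v *m v^T)),
        \tr (G *m Q) <= sum_pos_eigenvalues (Pmx S lambda)
      & \tr (E *m Q) = 0].
Proof.
move=> QS; pose P := Pmx S lambda; pose U := spectralmx P.
have PP : P ^t* = P := Pmx_selfadjoint S lambda.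
have UU : U *m U ^t* = 1%:M := spectralmxMadj P.
have AA : (S *m S ^t*) ^t* = S *m S ^t* by rewrite trmx_mul map_mxM trmxCK.
have [B [ABA BAh BAi]] := selfadjoint_pinv AA.
set A := S *m S ^t* in AA ABA BAh BAi.
(* With [Y] the difference of the two sides, [Y ^t* *m Y] ends in the factor [A - A *m B *m A],
   which is 0. *)
have SBA : S ^t* *m B *m A = S ^t*.
  apply/eqP; rewrite eq_sym -subr_eq0; apply/eqP.
  rewrite -[X in X - _]mulmx1 -mulmxA -mulmxBr.
  apply: mxtrace_mul_adj_eq0; rewrite mxtrace_mulC trmx_mul map_mxM trmxCK.
  by rewrite -mulmxA (mulmxA S) -/A mulmxBr mulmx1
    [A *m (B *m A)]mulmxA ABA subrr mulmx0 mxtrace0.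
pose p := spectral_diag P.
have p_real i : (complex.Re (p 0 i))%:C%C = p 0 i.
  apply/RRe_real/(eigenvalues_selfadjoint_real PP).
  by rewrite (perm_mem (perm_eigenvalues_spectral PP)) map_f// mem_enum.
pose d : 'rV[R[i]]_k := \row_i (Num.max (complex.Re (p 0 i)) 0)%:C%C.
have d_ge0 i : 0 <= d 0 i by rewrite mxE ler0c le_max lexx orbT.
(* [M] sends v to the coordinates of u = B S v in the eigenbasis of [P], where [d] is the diagonal
   of the positive part; [X] sends v to the residual v - S^* u. *)
pose M := U *m B *m S; pose X := 1%:M - S ^t* *m B *m S.
have trvv (v : 'cV[R]_N) m (Z : 'M[R[i]]_(m, N)) :
    Z *m complexmx (v *m v^T) *m Z ^t* =
      (Z *m complexmx v) *m (Z *m complexmx v) ^t*.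
  by rewrite complexmxM trmx_mul map_mxM complexmx_adj !mulmxA.
(* [W] is left general: it is v v^T in the pointwise bounds and [Q] in the trace bounds. *)
have GE W : \tr (map_mx (@complex.Re R) (M ^t* *m diag_mx d *m M) *m W) =
    complex.Re (\sum_i d 0 i * (M *m complexmx W *m M ^t*) i i).
  rewrite -mxtrace_diagM -Re_mxtrace_complexmx; congr (complex.Re _).
  by rewrite -!mulmxA mxtrace_mulC -!mulmxA.
have EE W : \tr (map_mx (@complex.Re R) (X ^t* *m X) *m W) =
    complex.Re (\tr (X *m complexmx W *m X ^t*)).
  by rewrite -Re_mxtrace_complexmx [in RHS]mxtrace_mulC mulmxA.
have Re_ge0 (x : R[i]) : 0 <= x -> 0 <= complex.Re x.
  by rewrite lecE => /andP[].
exists (map_mx (@complex.Re R) (M ^t* *m diag_mx d *m M)).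
exists (map_mx (@complex.Re R) (X ^t* *m X)); split.
- move=> v; rewrite GE trvv; apply/Re_ge0/sumr_ge0 => i _.
  by rewrite mulr_ge0// psd_diag_ge0.
- move=> v; rewrite EE trvv; apply/Re_ge0/mxtrace_psd_ge0.
- move=> v; rewrite EE GE !trvv => ReE.
  (* The hypothesis only kills the real part; the imaginary part vanishes because the trace is
     nonnegative in [R[i]]. *)
  have /mxtrace_mul_adj_eq0 Xv :
      \tr (X *m complexmx v *m (X *m complexmx v) ^t*) = 0.
    have := mxtrace_psd_ge0 (X *m complexmx v).
    by rewrite lecE => /andP[Im0 _]; apply/eqP; rewrite eq_complex ReE Im0 eqxx.
  pose y := M *m complexmx v.
  have vE : complexmx v = S ^t* *m U ^t* *m y.
    have U'U : U ^t* *m U = 1%:M := spectralmx_adjM P.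
    have -> : complexmx v = S ^t* *m B *m S *m complexmx v.
      by apply/eqP; rewrite -subr_eq0 -[X in X - _]mul1mx -mulmxBl Xv.
    by rewrite /y /M -!mulmxA [U ^t* *m (U *m _)]mulmxA U'U mul1mx.
  rewrite -/y.
  (* In the eigenbasis the portfolio value is the sum of p_i |y_i|^2, which is then compared term by
     term with the sum of p_i^+ |y_i|^2. *)
  have -> : \sum_n lambda n * v n 0 ^+ 2 =
      complex.Re (\sum_i p 0 i * (y *m y ^t*) i i).
    rewrite -mxtrace_diagM.
    have -> : \tr (diag_mx p *m (y *m y ^t*)) =
       \tr (complexmx (Lambdamx lambda) *m complexmx (v *m v^T)).
      rewrite complexmxM -complexmx_adj vE.
      have <- : U *m P *m U ^t* = diag_mx p.
        by rewrite (selfadjoint_spectral PP) -/U -/p -!mulmxA UU mulmx1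
          mulmxA UU mul1mx.
      rewrite /P /Pmx !trmx_mul !map_mxM !trmxCK -!mulmxA.
      do 2 rewrite mxtrace_mulC -!mulmxA; done.
    rewrite -complexmxM /mxtrace raddf_sum/=; apply: eq_bigr => n _.
    rewrite !mxE/= (bigD1 n)//= !mxE eqxx mulr1n big_ord1.
    rewrite !mxE big1 ?addr0 ?expr2//.
    by move=> j /negPf jn; rewrite !mxE eq_sym jn mul0r.
  rewrite -subr_ge0 -raddfB -sumrB; apply/Re_ge0/sumr_ge0 => i _.
  rewrite -mulrBl mulr_ge0 ?psd_diag_ge0// subr_ge0 mxE -p_real lecR.
  by rewrite le_max lexx.
(* [1%:M - B *m A] is the complementary orthogonal projection, so [M] turns [Q] into
   [1%:M - Z *m Z ^t*], whose diagonal entries are at most 1 and can only shrink the weights [d]. *)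
- pose Z := U *m (1%:M - B *m A).
  have MQM : M *m complexmx Q *m M ^t* = 1%:M - Z *m Z ^t*.
    have MS : M *m S ^t* = U *m (B *m A) by rewrite /M /A -!mulmxA.
    have -> : M *m complexmx Q *m M ^t* = (M *m S ^t*) *m (M *m S ^t*) ^t*.
      by rewrite QS [in RHS](trmx_mul M) map_mxM trmxCK !mulmxA.
    have BAc : (1%:M - B *m A) ^t* = 1%:M - B *m A.
      by rewrite raddfB/= raddfB/= BAh trmx1 map_mx1.
    have BAci : (1%:M - B *m A) *m (1%:M - B *m A) = 1%:M - B *m A.
      by rewrite mulmxBr mulmx1 mulmxBl mul1mx BAi subrr subr0.
    rewrite MS /Z (trmx_mul U (B *m A)) (trmx_mul U (_ - _)).
    rewrite [in LHS]map_mxM [in RHS]map_mxM BAh BAc.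
    rewrite [in LHS]mulmxA -[in LHS](mulmxA U) BAi.
    rewrite [in RHS](mulmxA (U *m _)) -[in RHS](mulmxA U (_ - _)) BAci.
    rewrite mulmxBr mulmx1 mulmxBl UU opprB.
    by rewrite addrC subrK.
  rewrite GE MQM /sum_pos_eigenvalues.
  rewrite (perm_big _ (perm_eigenvalues_spectral PP))/= big_map big_enum/=.
  rewrite raddf_sum ler_sum//= => i _.
  have -> : Num.max (complex.Re (p 0 i)) 0 = complex.Re (d 0 i) by rewrite mxE.
  rewrite -subr_ge0 -raddfB; apply: Re_ge0.
  have -> : (1%:M - Z *m Z ^t*) i i = 1 - (Z *m Z ^t*) i i.
    by rewrite !mxE eqxx.
  by rewrite mulrBr mulr1 opprB addrC subrK mulr_ge0// psd_diag_ge0.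
- have XS : X *m S ^t* = 0.
    by rewrite mulmxBl mul1mx -[_ *m S *m _]mulmxA -/A SBA subrr.
  by rewrite EE QS mulmxA XS !mul0mx mxtrace0.
Qed.

(** * Integration of quadratic forms in the square roots of the assets *)

Lemma measurable_sqrt_mul {R : realType} {d} {T : measurableType d}
    (f g : T -> R) :
  measurable_fun setT f -> measurable_fun setT g ->
  measurable_fun setT (fun w => Num.sqrt (f w * g w)).
Proof.
move=> mf mg; have msqrt : measurable_fun setT (@Num.sqrt R).
  by apply: continuous_measurable_fun; exact: sqrt_continuous.
apply: (measurableT_comp msqrt).
exact: measurable_funM.
Qed.

(** Domination by [f + g]: for nonnegative values, f g is at most (f + g)^2. *)
Lemma integrable_sqrt_mul {R : realType} {d} {T : measurableType d}
    (mu : {measure set T -> \bar R}) (f g : T -> R) :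
  (forall w, 0 <= f w) -> (forall w, 0 <= g w) ->
  mu.-integrable setT (EFin \o f) -> mu.-integrable setT (EFin \o g) ->
  mu.-integrable setT (fun w => (Num.sqrt (f w * g w))%:E).
Proof.
move=> f0 g0 intf intg.
have mf := measurable_int _ intf; have mg := measurable_int _ intg.
apply: le_integrable (integrableD measurableT intf intg) => //.
  apply/measurable_EFinP/measurable_sqrt_mul;
    exact/measurable_EFinP.
move=> w _ /=; rewrite lee_fin !ger0_norm ?sqrtr_ge0 ?addr_ge0//.
rewrite -ler_sqr ?nnegrE ?sqrtr_ge0 ?addr_ge0// sqr_sqrtr ?mulr_ge0//.
by have := f0 w; have := g0 w; nra.
Qed.

(** The entries of v v^T are the integrands defining [Qmx], so linearity of the integral suffices;
    their integrability makes [fine] invertible. *)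
Lemma price_mxtrace {R : realType} {d} {T : measurableType d}
    {z : {measure set T -> \bar R}} {N : nat} {a : 'I_N -> T -> R}
    (K : 'M[R]_N) :
  (forall n w, 0 <= a n w) ->
  (forall n, z.-integrable setT (EFin \o a n)) ->
  let v w := \col_n Num.sqrt (a n w) : 'cV[R]_N in
  z.-integrable setT (fun w => (\tr (K *m (v w *m (v w)^T)))%:E) /\
  price z (fun w => \tr (K *m (v w *m (v w)^T))) = (\tr (K *m Qmx z a))%:E.
Proof.
move=> a0 inta v.
pose s i j w := ((K i j)%:E * (Num.sqrt (a j w * a i w)%R)%:E)%E.
have ints i j : z.-integrable setT (fun w => (Num.sqrt (a i w * a j w))%:E).
  exact: integrable_sqrt_mul.
have trE w : (\tr (K *m (v w *m (v w)^T)))%:E = (\sum_i \sum_j s i j w)%E.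
  rewrite -sumEFin; apply: eq_bigr => i _.
  rewrite mxE -sumEFin; apply: eq_bigr => j _.
  by rewrite !mxE big_ord1 !mxE -sqrtrM.
have intS i : z.-integrable setT (fun w => \sum_j s i j w)%E.
  by apply: integrable_sum => // j _; exact: integrableZl.
split.
  by under eq_fun do rewrite trE; exact: integrable_sum.
rewrite /price; under eq_integral do rewrite trE.
rewrite integral_sum// -sumEFin; apply: eq_bigr => i _.
rewrite integral_sum//; last by move=> j; exact: integrableZl.
rewrite mxE -sumEFin; apply: eq_bigr => j _.
by rewrite integralZl// mxE EFinM fineK// integrable_fin_num.
Qed.

Theorem theorem2 (R : realType) (d : measure_display) (T : measurableType d)
    (z : {finite_measure set T -> \bar R}) (N : nat)
    (a : 'I_N -> T -> R) (lambda : 'I_N -> R)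
    (ha_meas : forall n : 'I_N, measurable_fun setT (a n))
    (ha_ge0 : forall (n : 'I_N) (w : T), 0 <= a n w)
    (ha_fin : forall n : 'I_N, (price z (a n) < +oo)%E)
    (k : nat) (S : 'M[R[i]]_(k, N))
    (hS : complexmx (Qmx z a) = S ^t* *m S) :
  (price z (fun w => (Num.max (\sum_(n < N) lambda n * a n w) 0)%R)
     <= (sum_pos_eigenvalues (Pmx S lambda))%:E)%E.
Proof.
have inta n : z.-integrable setT (EFin \o a n).
  apply/integrableP; split; first exact/measurable_EFinP.
  by under eq_integral do rewrite /= ger0_norm//; exact: ha_fin.
have [G [E [G0 E0 EG GQ EQ]]] := portfolio_majorant lambda hS.
pose v w := \col_n Num.sqrt (a n w) : 'cV[R]_N.
have [intG priceG] := price_mxtrace G ha_ge0 inta.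
have [intE priceE] := price_mxtrace E ha_ge0 inta.
apply: (@le_trans _ _ (price z (fun w => \tr (G *m (v w *m (v w)^T)))));
  last by rewrite priceG lee_fin.
(* Almost everywhere is all that is available: the majorant is only known to dominate where the form
   of [E] vanishes. *)
apply: ae_ge0_le_integral => //.
- by move=> w _; rewrite lee_fin le_max lexx orbT.
- apply/measurable_EFinP/measurable_maxr => //.
  apply: measurable_sum => n.
  exact: measurable_funM.
- by move=> w _; rewrite lee_fin G0.
- exact: measurable_int intG.
(* The form of [E] is nonnegative with integral [\tr (E *m Qmx z a)], which is 0, so it vanishes
   almost everywhere. *)
have : ae_eq z setT (fun w => (\tr (E *m (v w *m (v w)^T)))%:E) (cst 0%E).
  apply/(ae_eq_integral_abs _ _ _).1 => //; first exact: measurable_int intE.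
  under eq_integral do rewrite gee0_abs ?lee_fin ?E0//.
  by rewrite -/(price _ _) priceE EQ.
(* The form of [G] is nonnegative, so bounding the portfolio value itself also bounds its positive
   part. *)
apply: filterS => w /(_ I)[Ew] _; rewrite lee_fin ge_max G0 andbT.
apply: le_trans (EG _ Ew); rewrite le_eqVlt; apply/orP; left; apply/eqP.
by apply: eq_bigr => n _; rewrite mxE sqr_sqrtr.
Qed.
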